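(* Let $g_1,g_2\ge1$ and let $X=(X_1,X_2)$ be a discrete random variable on $\mathbb{Z}^{g_1}\times \mathbb{Z}^{g_2}$ (possibly with complex-valued distribution). Then the following are equivalent: (1) $X$ is a discrete Gaussian with $X_1,X_2$ independent. (2) $X$ is a discrete Gaussian with a matrix parameter of the block-diagonal form $B = \begin{pmatrix} B_{11} & 0 \\ 0 & B_{22} \end{pmatrix}$, with $B_{11}\in\mathbb{H}_{g_1}$, $B_{22}\in\mathbb{H}_{g_2}$. (3) $X_1,X_2$ are independent discrete Gaussians (on $\mathbb{Z}^{g_1}$ and $\mathbb{Z}^{g_2}$) with matrix parameters $B_{11}\in\mathbb{H}_{g_1}$ and $B_{22}\in\mathbb{H}_{g_2}$ respectively. Moreover, if $X$ is a discrete Gaussian with real parameters $B$ and $u$, these conditions are equivalent to (4) $X_1,X_2$ are uncorrelated.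
   Context: Notation: $\mathbf{e}(x)=e^{2\pi x}$. $\mathbb{H}_g=\{B\in\mathbb{C}^{g\times g} : B^t=B,\ \operatorname{Re}B\succ 0\}$. The Riemann theta function is $\theta\colon\mathbb{C}^g\times\mathbb{H}_g\to\mathbb{C}$, $\theta(u,B)=\sum_{n\in\mathbb{Z}^g}\mathbf{e}(-\frac12 n^tBn+n^tu)$, and $\Theta_g=\{(u,B)\in\mathbb{C}^g\times\mathbb{H}_g:\theta(u,B)=0\}$. For $(u,B)\notin\Theta_g$, the (complex) discrete Gaussian distribution with parameters $(u,B)$ is the complex-valued probability distribution on $\mathbb{Z}^g$ given by $p_\theta(n;u,B)=\frac{1}{\theta(u,B)}\mathbf{e}(-\frac12 n^tBn+n^tu)$ (the values sum to $1$). A random variable on $\mathbb{Z}^g$ is a discrete Gaussian with matrix parameter $B$ if its distribution is $p_\theta(\cdot;u,B)$ for some $u$ with $(u,B)\notin\Theta_g$; different parameters may give the same distribution. For possibly complex-valued distributions, marginals are obtained by summing, $X_1,X_2$ independent means $\mathbb{P}((X_1,X_2)=(n_1,n_2))=\mathbb{P}(X_1=n_1)\mathbb{P}(X_2=n_2)$ for all $n_1,n_2$, and uncorrelated means $\mathbb{E}[X_1X_2^t]=\mathbb{E}[X_1]\mathbb{E}[X_2]^t$. *)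

(* Defs.v *)
From HB Require Import structures.
From mathcomp Require Import all_boot all_order all_algebra.
From mathcomp Require Import complex.
From mathcomp Require Import all_classical all_reals all_analysis.

Set Implicit Arguments.
Unset Strict Implicit.
Unset Printing Implicit Defensive.

Import Order.TTheory GRing.Theory Num.Theory.

Local Open Scope classical_set_scope.
Local Open Scope ring_scope.
Local Open Scope complex_scope.

Section Summation.
Variables (R : realType) (T : choiceType).

(* Sum of an absolutely summable real family; the families considered below
   are indexed by a countable set and carry no preferred enumeration.  The
   value is meaningless when the family is not summable. *)
Definition rsum (f : T -> R) : R :=
  fine (\esum_(x in [set: T]) (f^\+ x)%:E)
  - fine (\esum_(x in [set: T]) (f^\- x)%:E).

Definition csummable (f : T -> R[i]) : Prop :=
  summable [set: T] (fun x => (ComplexField.Normc.normc (f x))%:E).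

Definition csum (f : T -> R[i]) : R[i] :=
  rsum (fun x => complex.Re (f x)) +i* rsum (fun x => complex.Im (f x)).

(* A complex-valued random variable has no underlying probability space: it is
   identified with its distribution, the family of point masses. *)
Definition complex_distribution (p : T -> R[i]) : Prop :=
  csummable p /\ csum p = 1.

Definition expectation (m n : nat) (p : T -> R[i]) (F : T -> 'M[R[i]]_(m, n)) :
    'M[R[i]]_(m, n) :=
  \matrix_(i, j) csum (fun x => p x * F x i j).

End Summation.

Section DiscreteGaussian.
Variable R : realType.

Definition cexp (z : R[i]) : R[i] :=
  (expR (complex.Re z) * cos (complex.Im z))
  +i* (expR (complex.Re z) * sin (complex.Im z)).

(* The convention is e(x) = exp (2 pi x), without the factor i. *)
Definition e2pi (z : R[i]) : R[i] := cexp ((2 * pi)%:C * z).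

Definition posdef (g : nat) (A : 'M[R]_g) : Prop :=
  forall v : 'cV[R]_g, v != 0 -> 0 < (v^T *m A *m v) 0 0.

(* The right half-space: it is the real part that is positive definite. *)
Definition siegel (g : nat) (B : 'M[R[i]]_g) : Prop :=
  B^T = B /\ posdef (map_mx (@complex.Re R) B).

Definition cvec (g : nat) (n : 'cV[int]_g) : 'cV[R[i]]_g := map_mx intr n.

Definition theta_term (g : nat) (u : 'cV[R[i]]_g) (B : 'M[R[i]]_g)
    (n : 'cV[int]_g) : R[i] :=
  e2pi (- (2^-1 * ((cvec n)^T *m B *m cvec n) 0 0) + ((cvec n)^T *m u) 0 0).

Definition theta (g : nat) (u : 'cV[R[i]]_g) (B : 'M[R[i]]_g) : R[i] :=
  csum (theta_term u B).

Definition p_theta (g : nat) (u : 'cV[R[i]]_g) (B : 'M[R[i]]_g)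
    (n : 'cV[int]_g) : R[i] :=
  (theta u B)^-1 * theta_term u B n.

Definition gaussian_with_parameters (g : nat) (p : 'cV[int]_g -> R[i])
    (u : 'cV[R[i]]_g) (B : 'M[R[i]]_g) : Prop :=
  [/\ siegel B, theta u B != 0 & forall n, p n = p_theta u B n].

Definition gaussian_with_matrix (g : nat) (p : 'cV[int]_g -> R[i])
    (B : 'M[R[i]]_g) : Prop :=
  exists u : 'cV[R[i]]_g, gaussian_with_parameters p u B.

Definition discrete_gaussian (g : nat) (p : 'cV[int]_g -> R[i]) : Prop :=
  exists B : 'M[R[i]]_g, gaussian_with_matrix p B.

Definition real_discrete_gaussian (g : nat) (p : 'cV[int]_g -> R[i]) : Prop :=
  exists (u : 'cV[R]_g) (B : 'M[R]_g),
    gaussian_with_parameters p (map_mx (real_complex R) u)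
                               (map_mx (real_complex R) B).

End DiscreteGaussian.

(* Z^g1 x Z^g2 is identified with Z^(g1 + g2) by stacking column vectors, so p
   is the joint distribution of (X1, X2). *)
Section Joint.
Variables (R : realType) (g1 g2 : nat) (p : 'cV[int]_(g1 + g2) -> R[i]).

Definition marginal1 (n1 : 'cV[int]_g1) : R[i] :=
  csum (fun n2 : 'cV[int]_g2 => p (col_mx n1 n2)).

Definition marginal2 (n2 : 'cV[int]_g2) : R[i] :=
  csum (fun n1 : 'cV[int]_g1 => p (col_mx n1 n2)).

Definition independent : Prop :=
  forall (n1 : 'cV[int]_g1) (n2 : 'cV[int]_g2),
    p (col_mx n1 n2) = marginal1 n1 * marginal2 n2.

Definition uncorrelated : Prop :=
  let X1 (n : 'cV[int]_(g1 + g2)) := cvec R (usubmx n) in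
  let X2 (n : 'cV[int]_(g1 + g2)) := cvec R (dsubmx n) in
  expectation p (fun n => X1 n *m (X2 n)^T)
  = expectation p X1 *m (expectation p X2)^T.

End Joint.

(* Main.v *)
(* Independence gives [p(n1, n2) p(0, 0) = p(n1, 0) p(0, n2)], which forces
   [e(- n1^t B12 n2) = 1] for all lattice points, so deleting the off-diagonal
   blocks of [B] does not change the terms of the theta series; conversely a
   block-diagonal series factors.

   For real parameters, exchanging the second blocks of [n] and [m] multiplies
   [p n * p m] by [e x] and changes the sign of [x], where
   [x = (n1 - m1)^t B12 (n2 - m2)].  If [X1] and [X2] are uncorrelated then the
   sum of [p n * p m * x] vanishes, hence so does that of the nonnegative terms
   [p n * p m * x * (e x - 1)]; therefore every [x] is zero and [B12 = 0]. *)
Require Import Defs.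
From HB Require Import structures.
From mathcomp Require Import all_boot all_order all_algebra.
From mathcomp Require Import complex ring lra.
From mathcomp Require Import all_classical all_reals all_analysis.

Set Implicit Arguments.
Unset Strict Implicit.
Unset Printing Implicit Defensive.

Import Order.TTheory GRing.Theory Num.Theory.

Local Open Scope classical_set_scope.
Local Open Scope ring_scope.
Local Open Scope complex_scope.

(** * Absolutely summable families *)

Section RealSums.
Variable R : realType.

Definition rsummable (T : choiceType) (f : T -> R) : Prop :=
  summable [set: T] (fun x => (f x)%:E).

Section OneType.
Variable T : choiceType.
Implicit Types f g : T -> R.

Lemma rsummable_le f g :
  rsummable g -> (forall x, `|f x| <= g x) -> rsummable f.
Proof.
rewrite /rsummable /summable => sg fg; apply: le_lt_trans sg.
by apply: le_esum => x _ /=; rewrite lee_fin (le_trans (fg x)) ?ler_norm.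
Qed.

Lemma eq_rsummable f g : f =1 g -> rsummable f -> rsummable g.
Proof. by move=> /funext ->. Qed.

Lemma rsummable_norm f : rsummable f <-> rsummable (fun x => `|f x|).
Proof.
rewrite /rsummable /summable; suff -> : (fun x => `|(`|f x|)%:E|%E) =
  (fun x => `|(f x)%:E|%E) by [].
by apply/funext => x /=; rewrite normr_id.
Qed.

Lemma rsummableD f g :
  rsummable f -> rsummable g -> rsummable (fun x => f x + g x).
Proof. by move=> sf sg; have := summableD sf sg. Qed.

Lemma rsummableN f : rsummable f -> rsummable (fun x => - f x).
Proof. by move=> sf; have := sf; rewrite /rsummable summableN. Qed.

Lemma rsummable_esum f : rsummable f -> (forall x, 0 <= f x) ->
  (\esum_(x in [set: T]) (f x)%:E \is a fin_num)%E.
Proof.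
rewrite /rsummable summableE => + f0.
by rewrite (eq_esum (b := fun x => (f x)%:E)) // => x _; rewrite gee0_abs ?lee_fin.
Qed.

Lemma rsum_ge0E f : (forall x, 0 <= f x) ->
  rsum f = fine (\esum_(x in [set: T]) (f x)%:E).
Proof.
move=> f0; rewrite /rsum [X in _ - fine X]esum1 ?subr0.
  by congr fine; apply: eq_esum => x _; rewrite /funrpos; congr EFin; exact/max_idPl.
move=> x _; rewrite /funrneg; congr EFin; apply/max_idPr.
by rewrite oppr_le0.
Qed.

(** Under summability the extended-real sum is finite, so [fine] loses no information. Facts about
    [esum] of nonnegative families thus transfer to [rsum]. *)
Lemma esum_rsum f : rsummable f -> (forall x, 0 <= f x) ->
  \esum_(x in [set: T]) (f x)%:E = (rsum f)%:E.
Proof. by move=> sf f0; rewrite rsum_ge0E// fineK// rsummable_esum. Qed.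

Lemma rsummable_funrpos f : rsummable f -> rsummable f^\+.
Proof.
move=> /rsummable_norm /rsummable_le; apply => x.
by rewrite ger0_norm ?funrpos_ge0// /funrpos ge_max ler_norm normr_ge0.
Qed.

Lemma rsummable_funrneg f : rsummable f -> rsummable f^\-.
Proof.
move=> /rsummable_norm /rsummable_le; apply => x.
by rewrite ger0_norm ?funrneg_ge0// /funrneg ge_max -normrN ler_norm normr_ge0.
Qed.

Lemma rsumE f : rsum f = rsum f^\+ - rsum f^\-.
Proof.
by rewrite (rsum_ge0E (funrpos_ge0 f)) (rsum_ge0E (funrneg_ge0 f)).
Qed.

Lemma ge0_rsumD f g : rsummable f -> rsummable g ->
  (forall x, 0 <= f x) -> (forall x, 0 <= g x) ->
  rsum (fun x => f x + g x) = rsum f + rsum g.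
Proof.
move=> sf sg f0 g0; rewrite !rsum_ge0E//; last by move=> x; rewrite addr_ge0.
rewrite -fineD ?rsummable_esum// -esumD//; move=> x _; by rewrite lee_fin.
Qed.

(** With [h = f - g], the identity [h^\+ + g = h^\- + f] holds pointwise between sums of nonnegative
    families. Additivity on both sides and rearrangement give the claim, although [h^\+] and [h^\-]
    need not be [f] and [g]. *)
Lemma ge0_rsumB f g : rsummable f -> rsummable g ->
  (forall x, 0 <= f x) -> (forall x, 0 <= g x) ->
  rsum (fun x => f x - g x) = rsum f - rsum g.
Proof.
move=> sf sg f0 g0; rewrite rsumE; set h := fun x => f x - g x.
have sh : rsummable h by apply: rsummableD => //; exact: rsummableN.
have [sp sn] := (rsummable_funrpos sh, rsummable_funrneg sh).
have : rsum (fun x => h^\+ x + g x) = rsum (fun x => h^\- x + f x).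
  congr rsum; apply/funext => x.
  have := congr1 (@^~ x) (funrposBneg h) => /=.
  by rewrite {3}/h; change ((h^\+ - h^\-) x) with (h^\+ x - h^\- x); lra.
rewrite !ge0_rsumD //; first lra.
all: by move=> x; rewrite ?funrpos_ge0 ?funrneg_ge0.
Qed.

Lemma rsumD f g : rsummable f -> rsummable g ->
  rsum (fun x => f x + g x) = rsum f + rsum g.
Proof.
move=> sf sg.
have [fp fn] := (rsummable_funrpos sf, rsummable_funrneg sf).
have [gp gn] := (rsummable_funrpos sg, rsummable_funrneg sg).
have -> : (fun x => f x + g x) =
    (fun x => (f^\+ x + g^\+ x) - (f^\- x + g^\- x)).
  apply/funext => x.
  have := congr1 (@^~ x) (funrposBneg f) => /=.
  have := congr1 (@^~ x) (funrposBneg g) => /=.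
  change ((f^\+ - f^\-) x) with (f^\+ x - f^\- x).
  by change ((g^\+ - g^\-) x) with (g^\+ x - g^\- x); lra.
rewrite ge0_rsumB; [|exact: rsummableD|exact: rsummableD| |].
- rewrite !ge0_rsumD//; try by move=> x; rewrite ?funrpos_ge0 ?funrneg_ge0.
  by rewrite (rsumE f) (rsumE g); lra.
all: by move=> x; rewrite addr_ge0 ?funrpos_ge0 ?funrneg_ge0.
Qed.

Lemma rsumN f : rsum (fun x => - f x) = - rsum f.
Proof.
rewrite (rsumE f) opprB (rsumE (\- f)).
by rewrite funrposN funrnegN.
Qed.

Lemma rsumB f g : rsummable f -> rsummable g ->
  rsum (fun x => f x - g x) = rsum f - rsum g.
Proof. by move=> sf sg; rewrite rsumD ?rsumN//; exact: rsummableN. Qed.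

Lemma ge0_esumZl c f : 0 <= c -> (forall x, 0 <= f x) ->
  \esum_(x in [set: T]) (c * f x)%:E
  = (c%:E * \esum_(x in [set: T]) (f x)%:E)%E.
Proof.
move=> c0 f0; rewrite /esum -ereal_supZl//; last first.
  apply/set0P; eexists; exists set0; last by reflexivity.
  exact: fsets_set0.
congr ereal_sup; rewrite image_comp; apply: eq_imagel => A _ /=.
rewrite ge0_mule_fsumr; last by move=> x; rewrite lee_fin.
by under eq_fsbigr do rewrite EFinM.
Qed.

Lemma rsummableZl c f : rsummable f -> rsummable (fun x => c * f x).
Proof.
move=> /rsummable_norm sf; apply/rsummable_norm.
rewrite (_ : (fun _ => _) = (fun x => `|c| * `|f x|)); last first.
  by apply/funext => x; rewrite normrM.
rewrite /rsummable summableE (eq_esum (b := fun x => (`|c| * `|f x|)%:E)).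
  by rewrite ge0_esumZl// fin_numM// rsummable_esum.
by move=> x _; rewrite gee0_abs// lee_fin mulr_ge0.
Qed.

Lemma rsumZl c f : rsummable f -> rsum (fun x => c * f x) = c * rsum f.
Proof.
move=> sf.
have ge0Z d g : 0 <= d -> (forall x, 0 <= g x) -> rsummable g ->
    rsum (fun x => d * g x) = d * rsum g.
  move=> d0 g0 sg; rewrite !rsum_ge0E//; last by move=> x; rewrite mulr_ge0.
  by rewrite ge0_esumZl// fineM// rsummable_esum.
have {}ge0Z d : 0 <= d -> rsum (fun x => d * f x) = d * rsum f.
  move=> d0; rewrite rsumE ge0_funrposM// ge0_funrnegM// (rsumE f) mulrBr.
  rewrite (ge0Z _ _ d0 (funrpos_ge0 f) (rsummable_funrpos sf)).
  by rewrite (ge0Z _ _ d0 (funrneg_ge0 f) (rsummable_funrneg sf)).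
have [/ge0Z//|/ltW c0] := leP 0 c.
rewrite -[c]opprK mulNr -ge0Z ?oppr_ge0// -rsumN.
by congr rsum; apply/funext => x; rewrite mulNr.
Qed.

(** Each single value is a finite partial sum, hence at most the total. *)
Lemma rsum_eq0 f : rsummable f -> (forall x, 0 <= f x) -> rsum f = 0 ->
  forall x, f x = 0.
Proof.
move=> sf f0 fz x; apply/eqP; rewrite eq_le f0 andbT -lee_fin.
rewrite -fz -esum_rsum// esum_ge//; exists [set x].
  by split; [exact: finite_set1|].
by rewrite fsbig_set1.
Qed.

Lemma rsum0 : rsum (fun _ : T => 0) = 0 :> R.
Proof. by rewrite rsum_ge0E// esum1. Qed.

Lemma rsummable0 : rsummable (fun _ : T => 0).
Proof. by rewrite /rsummable /summable esum1// => x _; rewrite abse0. Qed.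

End OneType.

(** * Reindexing and products of real families *)

Section TwoTypes.
Variables S T : choiceType.

Lemma rsummable_inj (e : S -> T) (f : T -> R) : injective e ->
  rsummable f -> rsummable (f \o e).
Proof.
rewrite /rsummable /summable => ie; apply: le_lt_trans.
have -> : \esum_(x in [set: S]) `|((f \o e) x)%:E|%E =
          \esum_(y in e @` [set: S]) `|(f y)%:E|%E.
  by rewrite esum_image// => x y _ _; exact: ie.
by rewrite esum_mkcond; apply: le_esum => y _; case: ifP => // _.
Qed.

Lemma rsum_reindex (e : S -> T) (f : T -> R) : bijective e ->
  rsum (f \o e) = rsum f.
Proof.
move=> be; have sb : set_bij [set: S] [set: T] e.
  case: be => e' K K'; split=> //.
    by move=> x y _ _ /(congr1 e'); rewrite !K.
  by move=> y _; exists (e' y).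
by rewrite /rsum; congr (fine _ - fine _);
  rewrite [in RHS](reindex_esum _ _ _ _ sb).
Qed.

Variables (f : S -> R) (g : T -> R).

(** Tonelli: by nonnegativity the sum over pairs is an iterated sum, whose inner sum at [x] is [f x]
    times the total of [g]. The right-hand side stays extended-real, so summability of the product
    family can be read off from it. *)
Lemma ge0_esumM : (forall x, 0 <= f x) -> (forall y, 0 <= g y) ->
  rsummable g ->
  \esum_(z in [set: (S * T)%type]) (f z.1 * g z.2)%:E
  = ((rsum g)%:E * \esum_(x in [set: S]) (f x)%:E)%E.
Proof.
move=> f0 g0 sg.
rewrite -ge0_esumZl//; last by rewrite rsum_ge0E// fine_ge0// esum_ge0// => x _; rewrite lee_fin.
have -> : [set: (S * T)%type] = [set: S] `*`` (fun=> [set: T]).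
  by apply/seteqP; split.
rewrite -(@esum_esum _ _ _ _ _ (fun x y => (f x * g y)%:E)).
  by apply: eq_esum => x _; rewrite ge0_esumZl// esum_rsum// muleC.
by move=> x y _ _; rewrite lee_fin mulr_ge0.
Qed.

End TwoTypes.

Section Product.
Variables S T : choiceType.

Lemma ge0_rsummableM (f : S -> R) (g : T -> R) :
  (forall x, 0 <= f x) -> (forall y, 0 <= g y) ->
  rsummable f -> rsummable g ->
  rsummable (fun z : S * T => f z.1 * g z.2).
Proof.
move=> f0 g0 sf sg; rewrite /rsummable summableE.
rewrite (eq_esum (b := fun z : S * T => (f z.1 * g z.2)%:E)).
  by rewrite ge0_esumM// fin_numM// rsummable_esum.
by move=> x _; rewrite gee0_abs// lee_fin mulr_ge0.
Qed.

Lemma ge0_rsumM (f : S -> R) (g : T -> R) :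
  (forall x, 0 <= f x) -> (forall y, 0 <= g y) ->
  rsummable f -> rsummable g ->
  rsum (fun z : S * T => f z.1 * g z.2) = rsum f * rsum g.
Proof.
move=> f0 g0 sf sg; rewrite [LHS]rsum_ge0E; last by move=> z; rewrite mulr_ge0.
by rewrite ge0_esumM// esum_rsum// -EFinM mulrC.
Qed.

Lemma rsummableM (f : S -> R) (g : T -> R) :
  rsummable f -> rsummable g -> rsummable (fun z : S * T => f z.1 * g z.2).
Proof.
move=> /rsummable_norm sf /rsummable_norm sg; apply/rsummable_norm.
apply: eq_rsummable (ge0_rsummableM _ _ sf sg) => //.
by move=> z; rewrite normrM.
Qed.

(** Splitting both factors into positive and negative parts leaves four products of nonnegative
    families. *)
Lemma rsumM (f : S -> R) (g : T -> R) :
  rsummable f -> rsummable g ->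
  rsum (fun z : S * T => f z.1 * g z.2) = rsum f * rsum g.
Proof.
move=> sf sg.
have [fp fn] := (rsummable_funrpos sf, rsummable_funrneg sf).
have [gp gn] := (rsummable_funrpos sg, rsummable_funrneg sg).
rewrite (_ : (fun _ => _) = (fun z : S * T =>
    (f^\+ z.1 * g^\+ z.2 + f^\- z.1 * g^\- z.2)
    - (f^\+ z.1 * g^\- z.2 + f^\- z.1 * g^\+ z.2))); last first.
  apply/funext => -[x y] /=.
  have <- : f^\+ x - f^\- x = f x by rewrite -[RHS](congr1 (@^~ x) (funrposBneg f)).
  have <- : g^\+ y - g^\- y = g y by rewrite -[RHS](congr1 (@^~ y) (funrposBneg g)).
  by ring.
rewrite rsumB; [|apply: rsummableD; exact: rsummableM|apply: rsummableD; exact: rsummableM].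
rewrite !rsumD; try exact: rsummableM.
rewrite !ge0_rsumM; try by move=> // x; rewrite ?funrpos_ge0 ?funrneg_ge0.
by rewrite (rsumE f) (rsumE g); ring.
Qed.

End Product.

End RealSums.

Section FiniteSums.
Variables (R : realType) (T : choiceType) (I : Type).

Lemma rsummable_sum (s : seq I) (F : I -> T -> R) :
  (forall i, rsummable (F i)) -> rsummable (fun x => \sum_(i <- s) F i x).
Proof.
move=> sF; elim: s => [|i s ih].
  by under eq_fun do rewrite big_nil; exact: rsummable0.
by under eq_fun do rewrite big_cons; exact: rsummableD.
Qed.

Lemma rsum_sum (s : seq I) (F : I -> T -> R) : (forall i, rsummable (F i)) ->
  rsum (fun x => \sum_(i <- s) F i x) = \sum_(i <- s) rsum (F i).
Proof.
move=> sF; elim: s => [|i s ih].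
  by under eq_fun do rewrite big_nil; rewrite big_nil rsum0.
under eq_fun do rewrite big_cons.
by rewrite big_cons rsumD ?ih//; exact: rsummable_sum.
Qed.

End FiniteSums.

(** * Complex families through their real and imaginary parts *)

Section ComplexSums.
Variable R : realType.
Local Notation C := R[i].

Lemma ReM (x y : C) : complex.Re (x * y)
  = complex.Re x * complex.Re y - complex.Im x * complex.Im y.
Proof. by case: x; case: y. Qed.

Lemma ImM (x y : C) : complex.Im (x * y)
  = complex.Re x * complex.Im y + complex.Im x * complex.Re y.
Proof. by case: x; case: y. Qed.

(** The modulus dominates the absolute value of each part and is at most the sum of the two. *)
Lemma csummableP (T : choiceType) (f : T -> C) :
  csummable f <-> rsummable (fun x => complex.Re (f x)) /\
                  rsummable (fun x => complex.Im (f x)).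
Proof.
split=> [sf|[/rsummable_norm sr /rsummable_norm si]].
  by split; apply: rsummable_le sf _ => x; case: (f x) => a b /=;
     rewrite -sqrtr_sqr ler_wsqrtr// ?lerDl ?lerDr sqr_ge0.
apply: rsummable_le (rsummableD sr si) _ => x; case: (f x) => a b /=.
rewrite ger0_norm ?sqrtr_ge0// -[leRHS]ger0_norm ?addr_ge0//.
rewrite -[leRHS]sqrtr_sqr ler_wsqrtr// sqrrD !real_normK ?num_real//.
by rewrite lerD2r lerDl mulrn_wge0// mulr_ge0.
Qed.

Lemma csummable_comp_inj (S T : choiceType) (e : S -> T) (f : T -> C) :
  injective e -> csummable f -> csummable (f \o e).
Proof.
move=> ie /csummableP[sr si]; apply/csummableP.
by split; [exact: (rsummable_inj ie sr)|exact: (rsummable_inj ie si)].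
Qed.

Lemma csum_reindex (S T : choiceType) (e : S -> T) (f : T -> C) :
  bijective e -> csum (f \o e) = csum f.
Proof.
move=> be; congr (_ +i* _).
  exact: (rsum_reindex (fun x => complex.Re (f x)) be).
exact: (rsum_reindex (fun x => complex.Im (f x)) be).
Qed.

Lemma csummableZl (T : choiceType) (c : C) (f : T -> C) :
  csummable f -> csummable (fun x => c * f x).
Proof.
move=> /csummableP[sr si]; apply/csummableP; split.
  under eq_fun do rewrite ReM -mulNr.
  by apply: rsummableD; exact: rsummableZl.
under eq_fun do rewrite ImM.
by apply: rsummableD; exact: rsummableZl.
Qed.

Lemma csumZl (T : choiceType) (c : C) (f : T -> C) :
  csummable f -> csum (fun x => c * f x) = c * csum f.
Proof.
move=> /csummableP[sr si]; rewrite /csum.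
under eq_fun do rewrite ReM.
under [X in _ +i* rsum X]eq_fun do rewrite ImM.
rewrite rsumB ?rsumD; try exact: rsummableZl.
by rewrite !rsumZl//; case: c.
Qed.

Lemma csumM (S T : choiceType) (f : S -> C) (g : T -> C) :
  csummable f -> csummable g ->
  csum (fun z : S * T => f z.1 * g z.2) = csum f * csum g.
Proof.
move=> /csummableP[fr fi] /csummableP[gr gi]; rewrite /csum.
under eq_fun do rewrite ReM.
under [X in _ +i* rsum X]eq_fun do rewrite ImM.
rewrite (rsumB (rsummableM fr gr) (rsummableM fi gi)).
rewrite (rsumD (rsummableM fr gi) (rsummableM fi gr)).
by rewrite (rsumM fr gr) (rsumM fi gi) (rsumM fr gi) (rsumM fi gr).
Qed.

Lemma csum_real (T : choiceType) (f : T -> R) :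
  csum (fun x => (f x)%:C) = (rsum f)%:C.
Proof. by rewrite /csum /= rsum0. Qed.

Lemma csummable_real (T : choiceType) (f : T -> R) :
  csummable (fun x => (f x)%:C) <-> rsummable f.
Proof.
by split=> [/csummableP[]//|sf]; apply/csummableP; split=> //; exact: rsummable0.
Qed.

End ComplexSums.

(** * Terms of the theta series *)

Section ThetaTerms.
Variable R : realType.
Local Notation C := R[i].

Lemma cexpD (x y : C) : cexp (x + y) = cexp x * cexp y.
Proof.
case: x y => [a b] [c d]; rewrite /cexp /= expRD sinD cosD.
by apply/eqP; rewrite eq_complex /=; apply/andP; split; apply/eqP; ring.
Qed.

Lemma cexp0 : cexp 0 = 1 :> C.
Proof. by rewrite /cexp /= expR0 cos0 sin0 mulr0 mulr1. Qed.

Lemma e2piD (x y : C) : e2pi (x + y) = e2pi x * e2pi y.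
Proof. by rewrite /e2pi mulrDr cexpD. Qed.

Lemma e2pi0 : e2pi 0 = 1 :> C.
Proof. by rewrite /e2pi mulr0 cexp0. Qed.

Lemma e2pi_neq0 (x : C) : e2pi x != 0.
Proof.
apply/eqP => ex; have := e2pi0; rewrite -(subrr x) e2piD ex mul0r => /eqP.
by rewrite eq_sym oner_eq0.
Qed.

Lemma e2pi_real (x : R) : e2pi x%:C = (expR (2 * pi * x))%:C.
Proof.
rewrite /e2pi /cexp /= !mul0r !mulr0 add0r sin0 cos0 mulr0 mulr1 subr0.
by [].
Qed.

Lemma cvecD g (m n : 'cV[int]_g) : cvec R (m + n) = cvec R m + cvec R n.
Proof. exact: map_mxD. Qed.

Lemma cvec0 g : cvec R (0 : 'cV[int]_g) = 0.
Proof. exact: map_mx0. Qed.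

Lemma cvec_col g1 g2 (n1 : 'cV[int]_g1) (n2 : 'cV[int]_g2) :
  cvec R (col_mx n1 n2) = col_mx (cvec R n1) (cvec R n2).
Proof. exact: map_col_mx. Qed.

Lemma theta_term_neq0 g (u : 'cV[C]_g) B n : theta_term u B n != 0.
Proof. exact: e2pi_neq0. Qed.

Lemma theta_term0 g (u : 'cV[C]_g) B : theta_term u B 0 = 1.
Proof.
by rewrite /theta_term cvec0 mulmx0 trmx0 mul0mx !mxE mulr0 oppr0 addr0 e2pi0.
Qed.

(** Polarisation of the quadratic form: by symmetry of [B] the two mixed terms agree, which cancels
    the factor 1/2. *)
Lemma theta_termD g (u : 'cV[C]_g) (B : 'M[C]_g) (m n : 'cV[int]_g) : B^T = B ->
  theta_term u B (m + n) = theta_term u B m * theta_term u B n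
    * e2pi (- ((cvec R m)^T *m B *m cvec R n) 0 0).
Proof.
move=> Bs; rewrite /theta_term -!e2piD cvecD; congr e2pi.
have addE (M N : 'M[C]_1) : (M + N) 0 0 = M 0 0 + N 0 0 by rewrite mxE.
(* A 1 by 1 matrix equals its transpose. *)
have sw : ((cvec R n)^T *m B *m cvec R m) 0 0 =
          ((cvec R m)^T *m B *m cvec R n) 0 0.
  transitivity (((cvec R n)^T *m B *m cvec R m)^T 0 0); first by rewrite [RHS]mxE.
  by rewrite !trmx_mul trmxK Bs mulmxA.
rewrite [(_ + _)^T]raddfD /= !mulmxDl !mulmxDr !addE sw.
by field.
Qed.

(** * Theta terms and the Siegel condition in block form *)

Section Blocks.
Variables g1 g2 : nat.

Lemma theta_term_col0 (u : 'cV[C]_(g1 + g2)) B (n : 'cV[int]_g1) :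
  theta_term u B (col_mx n 0) = theta_term (usubmx u) (ulsubmx B) n.
Proof.
rewrite /theta_term cvec_col cvec0 -{1}[u]vsubmxK -{1}[B]submxK tr_col_mx trmx0.
by rewrite mul_row_block !mul_row_col !mulmx0 !mul0mx !addr0.
Qed.

Lemma theta_term_0col (u : 'cV[C]_(g1 + g2)) B (n : 'cV[int]_g2) :
  theta_term u B (col_mx 0 n) = theta_term (dsubmx u) (drsubmx B) n.
Proof.
rewrite /theta_term cvec_col cvec0 -{1}[u]vsubmxK -{1}[B]submxK tr_col_mx trmx0.
by rewrite mul_row_block !mul_row_col !mulmx0 !mul0mx !add0r.
Qed.

(** Polarisation applied to [(n1, 0) + (0, n2)]: the mixed term sees only the upper right block. *)
Lemma theta_term_col (u : 'cV[C]_(g1 + g2)) B n1 n2 : B^T = B ->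
  theta_term u B (col_mx n1 n2) =
  theta_term (usubmx u) (ulsubmx B) n1 * theta_term (dsubmx u) (drsubmx B) n2
  * e2pi (- ((cvec R n1)^T *m ursubmx B *m cvec R n2) 0 0).
Proof.
move=> Bs; rewrite -theta_term_col0 -theta_term_0col.
have -> : col_mx n1 n2 = col_mx n1 0 + col_mx 0 n2.
  by rewrite add_col_mx addr0 add0r.
rewrite theta_termD//; congr (_ * e2pi (- _)).
rewrite !cvec_col !cvec0 -{1}[B]submxK tr_col_mx trmx0.
by rewrite mul_row_block !mul_row_col !mulmx0 !mul0mx !addr0 add0r.
Qed.

Lemma siegel_ul (B : 'M[C]_(g1 + g2)) : siegel B -> siegel (ulsubmx B).
Proof.
move=> [Bs Bp]; split; first by rewrite trmx_ulsub Bs.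
move=> v v0; have := Bp (col_mx v 0).
rewrite -{1}[B]submxK map_block_mx tr_col_mx trmx0.
rewrite mul_row_block !mul_row_col !mulmx0 !mul0mx !addr0; apply.
by apply: contra_neq v0; rewrite -col_mx0 => /eq_col_mx[].
Qed.

Lemma siegel_dr (B : 'M[C]_(g1 + g2)) : siegel B -> siegel (drsubmx B).
Proof.
move=> [Bs Bp]; split; first by rewrite trmx_drsub Bs.
move=> v v0; have := Bp (col_mx 0 v).
rewrite -{1}[B]submxK map_block_mx tr_col_mx trmx0.
rewrite mul_row_block !mul_row_col !mulmx0 !mul0mx !add0r; apply.
by apply: contra_neq v0; rewrite -col_mx0 => /eq_col_mx[].
Qed.

(** A nonzero vector has a nonzero block, which contributes strictly, while the other block
    contributes a nonnegative amount. *)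
Lemma siegel_block_diag (B11 : 'M[C]_g1) (B22 : 'M[C]_g2) :
  siegel B11 -> siegel B22 -> siegel (block_mx B11 0 0 B22).
Proof.
move=> [s1 p1] [s2 p2]; split; first by rewrite tr_block_mx s1 s2 !trmx0.
move=> v; rewrite -[v]vsubmxK; set v1 := usubmx v; set v2 := dsubmx v => v0.
rewrite map_block_mx !map_mx0 tr_col_mx mul_row_block mul_row_col.
rewrite !mulmx0 addr0 add0r mxE.
have ge0 h (A : 'M[R]_h) (w : 'cV[R]_h) : posdef A -> 0 <= (w^T *m A *m w) 0 0.
  by move=> Ap; have [->|/Ap/ltW//] := eqVneq w 0; rewrite mulmx0 mxE.
have [w1|w1] := eqVneq v1 0; last by rewrite ltr_pwDl ?p1 ?ge0.
have [w2|w2] := eqVneq v2 0; last by rewrite ltr_wpDl ?p2 ?ge0.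
by move: v0; rewrite w1 w2 col_mx0 eqxx.
Qed.

End Blocks.

End ThetaTerms.

(** * Independence and block-diagonal parameters *)

Section Independence.
Variables (R : realType) (g1 g2 : nat).
Local Notation C := R[i].
Implicit Types p : 'cV[int]_(g1 + g2) -> C.

Let join (z : 'cV[int]_g1 * 'cV[int]_g2) := col_mx z.1 z.2.

Lemma join_bij : bijective join.
Proof.
exists (fun n => (usubmx n, dsubmx n)) => [[n1 n2]|n] /=.
  by rewrite /join /= col_mxKu col_mxKd.
exact: vsubmxK.
Qed.

Lemma csum_prod (f : 'cV[int]_g1 -> C) (g : 'cV[int]_g2 -> C) p :
  csummable f -> csummable g ->
  (forall n1 n2, p (col_mx n1 n2) = f n1 * g n2) -> csum p = csum f * csum g.
Proof.
move=> sf sg pE; rewrite -(csum_reindex p join_bij) -csumM//.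
by congr csum; apply/funext => -[n1 n2] /=; rewrite -pE.
Qed.

Lemma csummable_colu p (n2 : 'cV[int]_g2) : csummable p ->
  csummable (fun n1 : 'cV[int]_g1 => p (col_mx n1 n2)).
Proof.
by apply: csummable_comp_inj => m n /eq_col_mx[].
Qed.

Lemma csummable_cold p (n1 : 'cV[int]_g1) : csummable p ->
  csummable (fun n2 : 'cV[int]_g2 => p (col_mx n1 n2)).
Proof.
by apply: csummable_comp_inj => m n /eq_col_mx[].
Qed.

(** By independence each marginal is a scalar multiple of a slice of [p] through the origin, and
    slices of a summable family are summable. *)
Lemma csummable_marginals p : csummable p -> independent p ->
  p 0 != 0 -> csummable (marginal1 p) /\ csummable (marginal2 p).
Proof.
move=> sp ip; have := ip 0 0; rewrite col_mx0 => -> nz.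
have [nz1 nz2] : marginal1 p 0 != 0 /\ marginal2 p 0 != 0.
  by move: nz; rewrite mulf_eq0 negb_or => /andP[].
split.
  rewrite (_ : marginal1 p =
    fun n1 => (marginal2 p 0)^-1 * p (col_mx n1 0)); last first.
    by apply/funext => n; rewrite ip mulrCA mulVf// mulr1.
  exact/csummableZl/csummable_colu.
rewrite (_ : marginal2 p =
  fun n2 => (marginal1 p 0)^-1 * p (col_mx 0 n2)); last first.
  by apply/funext => n; rewrite ip mulrA mulVf// mul1r.
exact/csummableZl/csummable_cold.
Qed.

Lemma gaussian_neq0 g (p : 'cV[int]_g -> C) : discrete_gaussian p ->
  forall n, p n != 0.
Proof.
move=> [B [u [_ t0 pE]]] n.
by rewrite pE mulf_neq0 ?invr_neq0 ?theta_term_neq0.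
Qed.

(** The distribution does not determine [B]. The off-diagonal block may be nonzero, for instance
    with entries in [i Z], and still contribute the factor 1 at every lattice point; the
    block-diagonal matrix then has the same theta terms, with the same [u]. *)
Lemma cross_eq1_block_diag p (u : 'cV[C]_(g1 + g2)) (B : 'M[C]_(g1 + g2)) :
  gaussian_with_parameters p u B ->
  (forall (n1 : 'cV[int]_g1) (n2 : 'cV[int]_g2),
     e2pi (- ((cvec R n1)^T *m ursubmx B *m cvec R n2) 0 0) = 1) ->
  exists (B11 : 'M[C]_g1) (B22 : 'M[C]_g2),
    [/\ siegel B11, siegel B22
      & gaussian_with_matrix p (block_mx B11 0 0 B22)].
Proof.
move=> [sB t0 pE] c1; exists (ulsubmx B), (drsubmx B).
have [s1 s2] := (siegel_ul sB, siegel_dr sB); split=> //.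
have sD := siegel_block_diag s1 s2.
have tE : theta_term u (block_mx (ulsubmx B) 0 0 (drsubmx B)) = theta_term u B.
  apply/funext => n; rewrite -[n]vsubmxK.
  rewrite (theta_term_col u _ _ (proj1 sB)) (theta_term_col u _ _ (proj1 sD)).
  rewrite [in RHS](c1 (usubmx n) (dsubmx n)).
  rewrite (block_mxKul (ulsubmx B) 0 0) (block_mxKdr (ulsubmx B) 0 0).
  rewrite (block_mxKur (ulsubmx B) 0 0).
  by rewrite mulmx0 mul0mx mxE oppr0 e2pi0.
exists u; split; [exact: sD|by rewrite /theta tE|].
by move=> n; rewrite pE /p_theta /theta tE.
Qed.

Lemma independent_block_diag p : discrete_gaussian p -> independent p ->
  exists (B11 : 'M[C]_g1) (B22 : 'M[C]_g2),
    [/\ siegel B11, siegel B22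
      & gaussian_with_matrix p (block_mx B11 0 0 B22)].
Proof.
move=> pg ip; have p0 := gaussian_neq0 pg.
move: pg => [B [u pg]]; apply: (cross_eq1_block_diag pg) => n1 n2.
case: pg => [[Bs _] t0 pE].
(* Both sides are the product of the same four marginal values. *)
have : p (col_mx n1 n2) * p 0 = p (col_mx n1 0) * p (col_mx 0 n2).
  by rewrite -[in p 0]col_mx0 !ip mulrACA [in RHS]mulrACA; congr (_ * _); rewrite mulrC.
rewrite !pE /p_theta theta_term0 (theta_term_col u _ _ Bs) theta_term_col0 theta_term_0col.
set t := theta _ _; set t1 := theta_term _ _ _; set t2 := theta_term _ _ _.
set c := e2pi _ => E; apply: (mulfI (x := t^-1 * t1 * (t^-1 * t2))).
  by rewrite !mulf_neq0 ?invr_neq0 ?theta_term_neq0.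
by rewrite mulr1 -[RHS]E; ring.
Qed.

Lemma block_diag_marginals p (B11 : 'M[C]_g1) (B22 : 'M[C]_g2) :
  csummable p -> siegel B11 -> siegel B22 ->
  gaussian_with_matrix p (block_mx B11 0 0 B22) ->
  [/\ independent p, gaussian_with_matrix (marginal1 p) B11
    & gaussian_with_matrix (marginal2 p) B22].
Proof.
move=> sp s1 s2 [u [sB t0 pE]].
set B := block_mx _ _ _ _ in sB t0 pE.
pose u1 := usubmx u; pose u2 := dsubmx u.
have tE (n1 : 'cV[int]_g1) (n2 : 'cV[int]_g2) :
    theta_term u B (col_mx n1 n2) = theta_term u1 B11 n1 * theta_term u2 B22 n2.
  rewrite (theta_term_col u _ _ (proj1 sB)).
  rewrite block_mxKul block_mxKdr block_mxKur.
  by rewrite mulmx0 mul0mx mxE oppr0 e2pi0 mulr1.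
(* Convergence of the theta series is read off from that of [p], of which it is a multiple. *)
have st : csummable (theta_term u B).
  rewrite (_ : theta_term u B = fun n => theta u B * p n).
    exact: csummableZl.
  by apply/funext => n; rewrite pE mulrA mulfV// mul1r.
(* Each factor is a slice of the full series, since the other factor is 1 at the origin. *)
have st1 : csummable (theta_term u1 B11).
  have := csummable_colu 0 st; congr csummable; apply/funext => n.
  by rewrite tE theta_term0 mulr1.
have st2 : csummable (theta_term u2 B22).
  have := csummable_cold 0 st; congr csummable; apply/funext => n.
  by rewrite tE theta_term0 mul1r.
have thE : theta u B = theta u1 B11 * theta u2 B22 by apply: csum_prod.
(* Neither factor vanishes because their product does not. *)
have [th1 th2] : theta u1 B11 != 0 /\ theta u2 B22 != 0.
  by move: t0; rewrite thE mulf_eq0 negb_or => /andP[].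
have m1 n1 : marginal1 p n1 = p_theta u1 B11 n1.
  rewrite /marginal1 (_ : (fun _ => _) = fun n2 =>
    ((theta u B)^-1 * theta_term u1 B11 n1) * theta_term u2 B22 n2).
    by rewrite csumZl// -/(theta u2 B22) thE /p_theta; field; rewrite ?th1 ?th2.
  by apply/funext => n2; rewrite pE /p_theta tE mulrA.
have m2 n2 : marginal2 p n2 = p_theta u2 B22 n2.
  rewrite /marginal2 (_ : (fun _ => _) = fun n1 =>
    ((theta u B)^-1 * theta_term u2 B22 n2) * theta_term u1 B11 n1).
    by rewrite csumZl// -/(theta u1 B11) thE /p_theta; field; rewrite ?th1 ?th2.
  by apply/funext => n1; rewrite pE /p_theta tE mulrAC mulrA.
split.
- move=> n1 n2; rewrite m1 m2 pE /p_theta tE thE.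
  by field; rewrite ?th1 ?th2.
- by exists u1.
- by exists u2.
Qed.

Lemma independent_gaussian_block_diag p (B11 : 'M[C]_g1) (B22 : 'M[C]_g2) :
  complex_distribution p -> independent p ->
  gaussian_with_matrix (marginal1 p) B11 ->
  gaussian_with_matrix (marginal2 p) B22 ->
  gaussian_with_matrix p (block_mx B11 0 0 B22).
Proof.
move=> [sp p1] ip [u1 [s1 th1 m1]] [u2 [s2 th2 m2]].
have sB := siegel_block_diag s1 s2.
have tE n : theta_term (col_mx u1 u2) (block_mx B11 0 0 B22) n
    = theta u1 B11 * theta u2 B22 * p n.
  rewrite -[n]vsubmxK ip m1 m2 /p_theta (theta_term_col _ _ _ (proj1 sB)).
  rewrite block_mxKul block_mxKdr block_mxKur col_mxKu col_mxKd.
  by rewrite mulmx0 mul0mx mxE oppr0 e2pi0; field; rewrite ?th1 ?th2.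
(* The terms are a constant multiple of [p], which has total mass 1, so the constant is the theta
   value. *)
have thE : theta (col_mx u1 u2) (block_mx B11 0 0 B22)
    = theta u1 B11 * theta u2 B22.
  by rewrite /theta (funext tE) csumZl// p1 mulr1.
exists (col_mx u1 u2); split=> //; first by rewrite thE mulf_neq0.
by move=> n; rewrite /p_theta tE thE mulKf// mulf_neq0.
Qed.

End Independence.

(** * Moments and correlation for real parameters *)

Section RealTheta.
Variables (R : realType) (g : nat).
Variables (u : 'cV[R]_g) (B : 'M[R]_g).
Local Notation uC := (map_mx (real_complex R) u).
Local Notation BC := (map_mx (real_complex R) B).

Definition rvec h (n : 'cV[int]_h) : 'cV[R]_h := map_mx intr n.

Definition rtheta_term (n : 'cV[int]_g) : R :=
  expR (2 * pi * (- (2^-1 * ((rvec n)^T *m B *m rvec n) 0 0)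
                  + ((rvec n)^T *m u) 0 0)).

Lemma cvecE h (n : 'cV[int]_h) : cvec R n = map_mx (real_complex R) (rvec n).
Proof. by apply/matrixP => i j; rewrite !mxE rmorph_int. Qed.

Lemma theta_term_real n : theta_term uC BC n = (rtheta_term n)%:C.
Proof.
rewrite /theta_term /rtheta_term -e2pi_real cvecE map_trmx -!map_mxM.
congr e2pi; rewrite rmorphD rmorphN rmorphM fmorphV /= rmorph_nat.
by congr (- (_ * _) + _); rewrite mxE.
Qed.

Lemma rtheta_term_gt0 n : 0 < rtheta_term n.
Proof. exact: expR_gt0. Qed.

Lemma siegel_real : siegel BC -> B^T = B /\ posdef B.
Proof.
move=> [Bs Bp]; split.
  by apply: (map_mx_inj (f := real_complex R)); rewrite -map_trmx.
by move: Bp; rewrite -map_mx_comp map_mx_id.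
Qed.

(** The quadratic form would vanish on a nonzero kernel vector. *)
Lemma posdef_unitmx : B^T = B -> posdef B -> B \in unitmx.
Proof.
move=> Bs Bp; rewrite unitmxE unitfE; apply/det0P => -[v v0 vB].
have := Bp v^T; rewrite trmxK vB mul0mx mxE ltxx => H.
suff : false by []. apply: H; by rewrite trmx_eq0.
Qed.

Lemma rtheta_termD m n : B^T = B ->
  rtheta_term (m + n) = rtheta_term m * rtheta_term n
    * expR (- (2 * pi * ((rvec m)^T *m B *m rvec n) 0 0)).
Proof.
move=> Bs; apply: (@complexI R).
have BCs : BC^T = BC by rewrite map_trmx Bs.
rewrite [RHS]rmorphM [X in _ = X * _]rmorphM /=.
rewrite -(theta_term_real (m + n)) -(theta_term_real m) -(theta_term_real n).
rewrite (theta_termD uC m n BCs); congr (_ * _); rewrite -mulrN -e2pi_real !cvecE map_trmx -!map_mxM.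
by rewrite rmorphN mxE.
Qed.

Hypothesis sB : siegel BC.
Hypothesis sq : rsummable rtheta_term.

(* Multiplying by [e(n^t B k)] translates the Gaussian by the lattice vector
   [k], so summability of the Gaussian itself already yields exponential
   moments, hence moments of all orders. *)
Lemma rsummable_exp_moment k : rsummable (fun n =>
  expR (2 * pi * ((rvec n)^T *m B *m rvec k) 0 0) * rtheta_term n).
Proof.
have [Bs _] := siegel_real sB.
have sh : injective (fun n : 'cV[int]_g => n - k) by move=> m n /addIr.
have := rsummableZl (rtheta_term (- k))^-1 (rsummable_inj sh sq).
apply: eq_rsummable => n /=.
have rN : rvec (- k) = - rvec k by exact: map_mxN.
rewrite rtheta_termD// rN mulmxN [X in 2 * pi * X]mxE mulrN opprK.
by field; rewrite gt_eqF ?rtheta_term_gt0.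
Qed.

(** By symmetry take [y] nonnegative, where the exponential dominates [1 + y^2 / 2]. This turns
    exponential moments into second moments. *)
Lemma sqr_le_expR (y : R) : y ^+ 2 <= 2 * (expR y + expR (- y)).
Proof.
wlog y0 : y / 0 <= y => [H|].
  have [/H//|/ltW yn] := leP 0 y.
  by rewrite -sqrrN (le_trans (H _ _)) ?oppr_ge0// opprK addrC.
have := expR_ge1Dxn 1 y0; have := expR_gt0 (- y).
by rewrite (_ : 2`! = 2)%N//; lra.
Qed.

Lemma rsummable_sqr_form j : rsummable (fun n =>
  ((rvec n)^T *m B) 0 j ^+ 2 * rtheta_term n).
Proof.
pose k : 'cV[int]_g := delta_mx j 0.
have s := rsummableD (rsummable_exp_moment k) (rsummable_exp_moment (- k)).
(* The constant comes from bounding the square of [2 * pi * x] and dividing by [(2 * pi)^2]. The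
   lattice vectors [k] and [- k] supply the two exponentials. *)
have := rsummable_le (rsummableZl (2 * (2 * pi) ^- 2) s); apply => n /=.
have kE : ((rvec n)^T *m B *m rvec k) 0 0 = ((rvec n)^T *m B) 0 j.
  have -> : rvec k = delta_mx j 0.
    by apply/matrixP => a b; rewrite !mxE rmorph_nat.
  by rewrite -colE mxE.
have kNE : ((rvec n)^T *m B *m rvec (- k)) 0 0 = - ((rvec n)^T *m B) 0 j.
  have -> : rvec (- k) = - rvec k by exact: map_mxN.
  by rewrite mulmxN mxE kE.
rewrite kE kNE; set x := _ 0 j; set q := rtheta_term n.
have q0 : 0 <= q by rewrite ltW ?rtheta_term_gt0.
have p0 : 0 < 2 * pi :> R by rewrite mulr_gt0 ?pi_gt0.
rewrite (ger0_norm (mulr_ge0 (sqr_ge0 x) q0)) -mulrDl mulrA ler_wpM2r//.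
rewrite mulrN [2 / _]mulrC -[leRHS]mulrA ler_pdivlMl ?exprn_gt0//.
by rewrite -exprMn; exact: sqr_le_expR.
Qed.

(** As [B] is invertible, the coordinates of [n] are fixed linear combinations of those of [n^t B],
    whose squares have already been bounded. *)
Lemma rsummable_moment2 i j : rsummable (fun n : 'cV[int]_g =>
  rtheta_term n * (n i 0)%:~R * (n j 0)%:~R).
Proof.
have [Bs Bp] := siegel_real sB; have Bu := posdef_unitmx Bs Bp.
pose x (n : 'cV[int]_g) := (rvec n)^T *m B.
have nE (n : 'cV[int]_g) a : (n a 0)%:~R = \sum_b x n 0 b * invmx B b a.
  have : (rvec n)^T = x n *m invmx B by rewrite mulmxK.
  by move/matrixP/(_ 0 a); rewrite !mxE.
(* Mixed products are dominated by the sum of the two squares. *)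
have sx a b : rsummable (fun n => x n 0 a * x n 0 b * rtheta_term n).
  apply: rsummable_le (rsummableD (rsummable_sqr_form a) (rsummable_sqr_form b)) _.
  move=> n; rewrite -mulrDl normrM (ger0_norm (ltW (rtheta_term_gt0 n))).
  rewrite ler_wpM2r ?(ltW (rtheta_term_gt0 n))// -/(x n).
  by rewrite ler_norml; apply/andP; split; nra.
have := rsummable_sum (index_enum 'I_g) (fun a =>
  rsummable_sum (index_enum 'I_g) (fun b =>
  rsummableZl (invmx B a i * invmx B b j) (sx a b))).
apply: eq_rsummable => n; rewrite !nE -mulrA mulr_suml mulr_sumr.
apply: eq_bigr => a _; rewrite !mulr_sumr; apply: eq_bigr => b _.
ring.
Qed.

Lemma rsummable_moment1 i : rsummable (fun n : 'cV[int]_g =>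
  rtheta_term n * (n i 0)%:~R).
Proof.
(* The bound is [|x| <= 1 + x^2]. *)
apply: rsummable_le (rsummableD sq (rsummable_moment2 i i)) _ => n.
have q0 := rtheta_term_gt0 n.
rewrite normrM (ger0_norm (ltW q0)) -{2}[rtheta_term n]mulr1 -mulrA -mulrDr.
rewrite ler_pM2l// ler_norml; apply/andP; split; nra.
Qed.

End RealTheta.

(** * Correlation in coordinates *)

Section Uncorrelated.
Variables (R : realType) (g1 g2 : nat).
Local Notation C := R[i].
Implicit Types p : 'cV[int]_(g1 + g2) -> C.

Lemma uncorrelatedP p : uncorrelated p <-> forall i j,
  csum (fun n => p n * ((n (lshift g2 i) 0)%:~R * (n (rshift g1 j) 0)%:~R)) =
  csum (fun n => p n * (n (lshift g2 i) 0)%:~R)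
  * csum (fun n => p n * (n (rshift g1 j) 0)%:~R).
Proof.
have lhs i j : Defs.expectation p (fun n => cvec R (usubmx n) *m (cvec R (dsubmx n))^T) i j
    = csum (fun n => p n * ((n (lshift g2 i) 0)%:~R * (n (rshift g1 j) 0)%:~R)).
  rewrite mxE; congr csum; apply/funext => n; congr (_ * _).
  by rewrite mxE big_ord1 !mxE.
have rhs i j : (Defs.expectation p (fun n => cvec R (usubmx n))
      *m (Defs.expectation p (fun n => cvec R (dsubmx n)))^T) i j
    = csum (fun n => p n * (n (lshift g2 i) 0)%:~R)
      * csum (fun n => p n * (n (rshift g1 j) 0)%:~R).
  rewrite mxE big_ord1 !mxE.
  by congr (_ * _); congr csum; apply/funext => n; rewrite !mxE.
split=> [unc i j|unc]; first by rewrite -lhs -rhs unc.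
by apply/matrixP => i j; rewrite lhs rhs unc.
Qed.

Lemma independent_uncorrelated p : complex_distribution p -> independent p ->
  p 0 != 0 -> (forall i, csummable (fun n => p n * (n i 0)%:~R)) ->
  uncorrelated p.
Proof.
move=> [sp p1] ip p0 sm; apply/uncorrelatedP => i j.
have [s1 s2] := csummable_marginals sp ip p0.
have p00 : p 0 = marginal1 p 0 * marginal2 p 0 by rewrite -ip col_mx0.
have [nz1 nz2] : marginal1 p 0 != 0 /\ marginal2 p 0 != 0.
  by move: p0; rewrite p00 mulf_eq0 negb_or => /andP[].
(* The moment of the marginal is a multiple of the slice at [n2 = 0] of the moment of [p]. *)
have sf : csummable (fun n1 => marginal1 p n1 * (n1 i 0)%:~R).
  have := csummableZl (marginal2 p 0)^-1 (csummable_colu 0 (sm (lshift g2 i))).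
  congr csummable; apply/funext => n1.
  by rewrite ip col_mxEu; field.
have sg : csummable (fun n2 => marginal2 p n2 * (n2 j 0)%:~R).
  have := csummableZl (marginal1 p 0)^-1 (csummable_cold 0 (sm (rshift g1 j))).
  congr csummable; apply/funext => n2.
  by rewrite ip col_mxEd; field.
rewrite (csum_prod sf sg); last first.
  by move=> n1 n2; rewrite ip col_mxEu col_mxEd mulrACA.
rewrite (csum_prod sf s2); last first.
  by move=> n1 n2; rewrite ip col_mxEu mulrAC.
rewrite (csum_prod s1 sg); last first.
  by move=> n1 n2; rewrite ip col_mxEd mulrA.
(* The two sides differ by the product of the total masses of the marginals, which is the total mass
   of [p], namely 1. *)
by rewrite mulrACA [_ * csum (marginal1 p)]mulrC mulrACA -(csum_prod s1 s2 ip)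
  p1 mul1r.
Qed.

End Uncorrelated.

(** * Gaussians with real parameters on a product of lattices *)

Lemma rtheta_term_col (R : realType) g1 g2 (u : 'cV[R]_(g1 + g2)) B
    (n1 : 'cV[int]_g1) (n2 : 'cV[int]_g2) : B^T = B ->
  rtheta_term u B (col_mx n1 n2) =
  rtheta_term (usubmx u) (ulsubmx B) n1 * rtheta_term (dsubmx u) (drsubmx B) n2
  * expR (- (2 * pi * ((rvec R n1)^T *m ursubmx B *m rvec R n2) 0 0)).
Proof.
move=> Bs; apply: (@complexI R).
have BCs : (map_mx (real_complex R) B)^T = map_mx (real_complex R) B.
  by rewrite map_trmx Bs.
rewrite [RHS]rmorphM [X in _ = X * _]rmorphM /=.
rewrite -(theta_term_real u B) -(theta_term_real (usubmx u) (ulsubmx B) n1).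
rewrite -(theta_term_real (dsubmx u) (drsubmx B) n2).
rewrite (theta_term_col _ _ _ BCs) -map_ursubmx -map_ulsubmx -map_drsubmx.
rewrite -map_usubmx -map_dsubmx; congr (_ * _).
by rewrite -mulrN -e2pi_real !cvecE map_trmx -!map_mxM rmorphN mxE.
Qed.

Section RealGaussian.
Variables (R : realType) (g1 g2 : nat).
Local Notation C := R[i].
Variables (p : 'cV[int]_(g1 + g2) -> C) (u : 'cV[R]_(g1 + g2)).
Variable B : 'M[R]_(g1 + g2).
Hypothesis dp : complex_distribution p.
Hypothesis pg : gaussian_with_parameters p (map_mx (real_complex R) u)
                  (map_mx (real_complex R) B).

Let q := rtheta_term u B.
Let P n := (rsum q)^-1 * q n.

Lemma real_gaussianE n : p n = (P n)%:C.
Proof.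
case: pg => _ _ ->; rewrite /p_theta theta_term_real /theta.
by rewrite (funext (theta_term_real u B)) csum_real -/q /P rmorphM fmorphV.
Qed.

Lemma real_gaussian_rsummable : rsummable P.
Proof.
by case: dp => + _; rewrite (funext real_gaussianE) csummable_real.
Qed.

Lemma real_gaussian_rsum : rsum P = 1.
Proof.
by case: dp => _; rewrite (funext real_gaussianE) csum_real => /complexI.
Qed.

(** Since [0^-1 = 0], a vanishing normalisation would make [P] identically zero, against its total
    mass 1. *)
Lemma rsum_rtheta_neq0 : rsum q != 0.
Proof.
apply/eqP => q0; have := real_gaussian_rsum.
rewrite (_ : P = fun=> 0) ?rsum0; first by move/eqP; rewrite eq_sym oner_eq0.
by apply/funext => n; rewrite /P q0 invr0 mul0r.
Qed.

Lemma rsummable_rtheta : rsummable q.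
Proof.
have := rsummableZl (rsum q) real_gaussian_rsummable; apply: eq_rsummable => n.
by rewrite /P mulVKf// rsum_rtheta_neq0.
Qed.

Lemma real_gaussian_moment1 i : rsummable (fun n => P n * (n i 0)%:~R).
Proof.
have [sB _ _] := pg.
have := rsummableZl (rsum q)^-1 (rsummable_moment1 sB rsummable_rtheta i).
by apply: eq_rsummable => n; rewrite /P mulrA.
Qed.

Lemma real_gaussian_moment2 i j :
  rsummable (fun n => P n * ((n i 0)%:~R * (n j 0)%:~R)).
Proof.
have [sB _ _] := pg.
have := rsummableZl (rsum q)^-1 (rsummable_moment2 sB rsummable_rtheta i j).
by apply: eq_rsummable => n; rewrite /P !mulrA.
Qed.

Lemma real_gaussian_independent_uncorrelated : independent p -> uncorrelated p.
Proof.
move=> ip; apply: independent_uncorrelated => //.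
  by apply: gaussian_neq0; eexists; eexists; exact: pg.
move=> i; have := real_gaussian_moment1 i; rewrite -csummable_real.
congr csummable; apply/funext => n.
by rewrite real_gaussianE rmorphM rmorph_int.
Qed.

(* The exponent gained by [P n * P m] when the second blocks of [n] and [m]
   are exchanged. *)
Let cross (z : 'cV[int]_(g1 + g2) * 'cV[int]_(g1 + g2)) : R :=
  ((rvec R (usubmx z.1 - usubmx z.2))^T *m ursubmx B
    *m rvec R (dsubmx z.1 - dsubmx z.2)) 0 0.

Let swap (z : 'cV[int]_(g1 + g2) * 'cV[int]_(g1 + g2)) :=
  (col_mx (usubmx z.1) (dsubmx z.2), col_mx (usubmx z.2) (dsubmx z.1)).

Lemma swap_bij : bijective swap.
Proof.
by apply: inv_bij => -[m n]; rewrite /swap /= !col_mxKu !col_mxKd !vsubmxK.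
Qed.

Lemma cross_swap z : cross (swap z) = - cross z.
Proof.
rewrite /cross /swap /= !col_mxKu !col_mxKd -(opprB (dsubmx z.1)).
have -> : rvec R (- (dsubmx z.1 - dsubmx z.2)) = - rvec R (dsubmx z.1 - dsubmx z.2).
  exact: map_mxN.
by rewrite mulmxN mxE.
Qed.

Lemma weight_swap z : P (swap z).1 * P (swap z).2
  = P z.1 * P z.2 * expR (2 * pi * cross z).
Proof.
case: z => m n; have [/siegel_real[Bs _] _ _] := pg.
set a := usubmx m; set b := dsubmx m; set a' := usubmx n; set b' := dsubmx n.
pose f (x : 'cV[int]_g1) (y : 'cV[int]_g2) : R :=
  ((rvec R x)^T *m ursubmx B *m rvec R y) 0 0.
have crossE : cross (m, n) = f a b - f a' b - f a b' + f a' b'.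
  rewrite /cross /= -/a -/b -/a' -/b' /f.
  have rB h (x y : 'cV[int]_h) : rvec R (x - y) = rvec R x - rvec R y.
    exact: map_mxB.
  rewrite !rB [(_ - _)^T]raddfB /= !mulmxBl !mulmxBr.
  have addE (M N : 'M[R]_1) : (M - N) 0 0 = M 0 0 - N 0 0 by rewrite !mxE.
  by rewrite !addE; ring.
have PE x y : P (col_mx x y) = (rsum q)^-1 *
    (rtheta_term (usubmx u) (ulsubmx B) x * rtheta_term (dsubmx u) (drsubmx B) y
     * expR (- (2 * pi * f x y))).
  by rewrite /P /q (rtheta_term_col u _ _ Bs).
have Pm : P m = P (col_mx a b) by rewrite vsubmxK.
have Pn : P n = P (col_mx a' b') by rewrite vsubmxK.
rewrite crossE /swap /= Pm Pn -/a -/b -/a' -/b' !PE.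
(* The exchange only permutes the factors depending on a single block; the whole change sits in the
   mixed exponentials. *)
have E : expR (- (2 * pi * f a b')) * expR (- (2 * pi * f a' b)) =
    expR (- (2 * pi * f a b)) * expR (- (2 * pi * f a' b'))
    * expR (2 * pi * (f a b - f a' b - f a b' + f a' b')).
  by rewrite -!expRD; congr expR; ring.
set c := (rsum q)^-1; set ta := rtheta_term _ _ a; set ta' := rtheta_term _ _ a'.
set tb := rtheta_term _ _ b; set tb' := rtheta_term _ _ b'.
transitivity (c ^+ 2 * (ta * tb * ta' * tb') *
  (expR (- (2 * pi * f a b')) * expR (- (2 * pi * f a' b)))); first by ring.
by rewrite E; ring.
Qed.

Lemma cross_sumE z : cross z = \sum_i \sum_j ursubmx B i j *
  (((z.1 (lshift g2 i) 0)%:~R - (z.2 (lshift g2 i) 0)%:~R)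
   * ((z.1 (rshift g1 j) 0)%:~R - (z.2 (rshift g1 j) 0)%:~R)).
Proof.
rewrite /cross mxE.
under eq_bigr do rewrite mxE mulr_suml.
rewrite exchange_big; apply: eq_bigr => i _; apply: eq_bigr => j _.
by rewrite !mxE !rmorphB /=; ring.
Qed.

(** The weights [P z.1 * P z.2] are the law of two independent copies of the pair. The expected
    product of the differences of two coordinates is then twice their covariance, hence zero, and
    [cross] is a linear combination of such products. *)
Lemma cross_moment : uncorrelated p ->
  rsummable (fun z => P z.1 * P z.2 * cross z) /\
  rsum (fun z => P z.1 * P z.2 * cross z) = 0.
Proof.
move=> /uncorrelatedP unc.
pose m1 i := rsum (fun n => P n * (n i 0)%:~R).
pose m2 i j := rsum (fun n => P n * ((n i 0)%:~R * (n j 0)%:~R)).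
have mE i j : m2 (lshift g2 i) (rshift g1 j) = m1 (lshift g2 i) * m1 (rshift g1 j).
  apply: (@complexI R); rewrite rmorphM /= -!csum_real.
  have := unc i j; congr (_ = _ * _); congr csum; apply/funext => n;
    by rewrite real_gaussianE !rmorphM !rmorph_int.
have sP := real_gaussian_rsummable.
(* Each of the four products is arranged as a function of [z.1] times a function of [z.2], so that
   its sum factors into moments. *)
pose F i j (z : 'cV[int]_(g1 + g2) * 'cV[int]_(g1 + g2)) :=
  ursubmx B i j * (P z.1 * ((z.1 (lshift g2 i) 0)%:~R * (z.1 (rshift g1 j) 0)%:~R) * P z.2
  - (P z.1 * (z.1 (lshift g2 i) 0)%:~R) * (P z.2 * (z.2 (rshift g1 j) 0)%:~R)
  + (P z.1 * (P z.2 * ((z.2 (lshift g2 i) 0)%:~R * (z.2 (rshift g1 j) 0)%:~R))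
  - (P z.1 * (z.1 (rshift g1 j) 0)%:~R) * (P z.2 * (z.2 (lshift g2 i) 0)%:~R))).
have FE z : P z.1 * P z.2 * cross z = \sum_i \sum_j F i j z.
  rewrite cross_sumE mulr_sumr; apply: eq_bigr => i _; rewrite mulr_sumr.
  by apply: eq_bigr => j _; rewrite /F; ring.
rewrite (funext FE).
have FP i j : rsummable (F i j) /\ rsum (F i j) = 0.
  have a1 := rsummableM (real_gaussian_moment2 (lshift g2 i) (rshift g1 j)) sP.
  have a2 := rsummableM (real_gaussian_moment1 (lshift g2 i))
                        (real_gaussian_moment1 (rshift g1 j)).
  have a3 := rsummableM sP (real_gaussian_moment2 (lshift g2 i) (rshift g1 j)).
  have a4 := rsummableM (real_gaussian_moment1 (rshift g1 j))
                        (real_gaussian_moment1 (lshift g2 i)).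
  have b1 := rsummableD a1 (rsummableN a2).
  have b2 := rsummableD a3 (rsummableN a4).
  have b3 := rsummableD b1 b2.
  split; first exact: rsummableZl b3.
  rewrite /F (rsumZl _ b3) (rsumD b1 b2) (rsumB a1 a2) (rsumB a3 a4).
  rewrite (rsumM (real_gaussian_moment2 (lshift g2 i) (rshift g1 j)) sP).
  rewrite (rsumM sP (real_gaussian_moment2 (lshift g2 i) (rshift g1 j))).
  rewrite (rsumM (real_gaussian_moment1 (lshift g2 i))
                 (real_gaussian_moment1 (rshift g1 j))).
  rewrite (rsumM (real_gaussian_moment1 (rshift g1 j))
                 (real_gaussian_moment1 (lshift g2 i))).
  rewrite -/(m2 _ _) -/(m1 _) -/(m1 _) mE real_gaussian_rsum; ring.
have sF i : rsummable (fun z => \sum_j F i j z).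
  by apply: rsummable_sum => j; have [] := FP i j.
split; first exact: rsummable_sum.
rewrite (rsum_sum _ sF) big1// => i _.
by rewrite rsum_sum ?big1// => j; have [] := FP i j.
Qed.

Lemma uncorrelated_cross_eq0 z : uncorrelated p -> cross z = 0.
Proof.
move=> unc; have [sx x0] := cross_moment unc.
pose K z := P z.1 * P z.2 * cross z.
have sK : rsummable (K \o swap) by apply: rsummable_inj sx; exact: bij_inj swap_bij.
(* Symmetrising under the exchange replaces a summand of unknown sign by a nonnegative one. *)
have KE y : - (K (swap y) + K y)
    = P y.1 * P y.2 * (cross y * (expR (2 * pi * cross y) - 1)).
  by rewrite /K weight_swap cross_swap; ring.
(* The normalising constant occurs squared, so it suffices that it is nonzero. *)
have P2 y : 0 < P y.1 * P y.2.
  rewrite /P mulrACA; apply: mulr_gt0; last by apply: mulr_gt0; exact: rtheta_term_gt0.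
  by rewrite -expr2 exprn_even_gt0// invr_neq0// rsum_rtheta_neq0.
(* Both factors have the same sign. *)
have xe y : 0 <= y * (expR (2 * pi * y) - 1) :> R.
  have p0 : 0 < 2 * pi :> R by rewrite mulr_gt0 ?pi_gt0.
  have [y0|y0] := leP 0 y.
    by rewrite mulr_ge0// subr_ge0 -[leLHS]expR0 ler_expR mulr_ge0// ltW.
  rewrite nmulr_rge0// subr_le0 -[leRHS]expR0 ler_expR.
  by rewrite pmulr_rle0// ltW.
have sS := rsummableN (rsummableD sK sx).
(* A nonnegative family of sum zero vanishes termwise; [K] and its exchanged form both sum to zero
   because the exchange is a bijection. *)
have : - (K (swap z) + K z) = 0.
  apply: (rsum_eq0 sS) => [y|].
    by change (0 <= - (K (swap y) + K y)); rewrite KE mulr_ge0 ?xe// ltW.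
  by rewrite rsumN (rsumD sK sx) (rsum_reindex K swap_bij) /K x0 addr0 oppr0.
rewrite KE.
move/eqP; rewrite mulf_eq0 gt_eqF ?P2//= mulf_eq0 => /orP[/eqP//|].
rewrite subr_eq0 -[eqbRHS]expR0 => /eqP/expR_inj/eqP.
by rewrite mulf_eq0 gt_eqF ?mulr_gt0 ?pi_gt0//= => /eqP.
Qed.

Lemma real_gaussian_uncorrelated_block_diag : uncorrelated p ->
  exists (B11 : 'M[C]_g1) (B22 : 'M[C]_g2),
    [/\ siegel B11, siegel B22
      & gaussian_with_matrix p (block_mx B11 0 0 B22)].
Proof.
move=> unc; apply: (cross_eq1_block_diag pg) => n1 n2.
(* Paired with the origin, [cross] becomes the bilinear form of the off-diagonal block at [n1] and
   [n2]. *)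
have := uncorrelated_cross_eq0 (col_mx n1 n2, 0) unc.
have u0 : usubmx (0 : 'cV[int]_(g1 + g2)) = 0 by rewrite -col_mx0 col_mxKu.
have d0 : dsubmx (0 : 'cV[int]_(g1 + g2)) = 0 by rewrite -col_mx0 col_mxKd.
rewrite /cross /= col_mxKu col_mxKd u0 d0 !subr0 => c0.
rewrite -map_ursubmx !cvecE map_trmx -!map_mxM.
rewrite [X in - X]mxE c0.
by rewrite oppr0 e2pi0.
Qed.

End RealGaussian.

Theorem proposition3p9 (R : realType) (g1 g2 : nat)
    (hg1 : (1 <= g1)%N) (hg2 : (1 <= g2)%N)
    (p : 'cV[int]_(g1 + g2) -> R[i]) (hp : complex_distribution p) :
  let cond1 := discrete_gaussian p /\ independent p in
  let cond2 :=
    exists (B11 : 'M[R[i]]_g1) (B22 : 'M[R[i]]_g2),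
      [/\ siegel B11, siegel B22
        & gaussian_with_matrix p (block_mx B11 0 0 B22)] in
  let cond3 :=
    exists (B11 : 'M[R[i]]_g1) (B22 : 'M[R[i]]_g2),
      [/\ siegel B11, siegel B22, independent p,
          gaussian_with_matrix (marginal1 p) B11
        & gaussian_with_matrix (marginal2 p) B22] in
  let cond4 := uncorrelated p in
  [/\ cond1 <-> cond2, cond2 <-> cond3
    & real_discrete_gaussian p ->
      [/\ cond1 <-> cond4, cond2 <-> cond4 & cond3 <-> cond4]].
Proof.
move=> cond1 cond2 cond3 cond4.
have c12 : cond1 -> cond2 by move=> [pg ip]; exact: independent_block_diag.
have c23 : cond2 -> cond3.
  move=> [B11 [B22 [s1 s2 pB]]]; exists B11, B22.
  by have [] := block_diag_marginals (proj1 hp) s1 s2 pB.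
have c31 : cond3 -> cond1.
  move=> [B11 [B22 [s1 s2 ip m1 m2]]]; split=> //; eexists.
  exact: independent_gaussian_block_diag hp ip m1 m2.
split; [by split; auto|by split; auto|].
move=> [u [B pg]].
(* The fourth condition joins the cycle between the first and the second. *)
have c14 : cond1 -> cond4.
  by move=> [_ ip]; exact: real_gaussian_independent_uncorrelated hp pg ip.
have c42 : cond4 -> cond2.
  exact: real_gaussian_uncorrelated_block_diag hp pg.
by split; split; auto.
Qed.
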